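(* Let $N\ge 1$ and $\Theta=(\theta_1,\dots,\theta_N)\in(0,\infty)^N$. A random field $X=(X_t)_{t\in\mathbb{Z}^N}$ is stationary if and only if the following two conditions are satisfied. (i) For every $j\in\{1,\dots,N\}$ and all $t_1,\dots,t_{j-1},t_{j+1},\dots,t_N\in\mathbb{Z}$, $$e^{m\theta_j}X_{t_1,\dots,t_{j-1},m,t_{j+1},\dots,t_N}\longrightarrow 0\quad\text{in probability as } m\to-\infty.$$ (ii) There exists $G=(G_t)_{t\in\mathbb{Z}^N}\in\mathcal{G}_\Theta$ such that $$X_t=\langle\hat\Theta,\hat X_t^-\rangle+\Delta_tG\quad\text{for every } t\in\mathbb{Z}^N.$$ Moreover, for a given $\Theta$ (and a given stationary $X$), the field $G\in\mathcal{G}_\Theta$ in (ii) is unique.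
   Context: A random field $X=(X_t)_{t\in\mathbb{Z}^N}$ is a family of real-valued random variables on a common probability space. Write $\langle\cdot,\cdot\rangle$ for the standard inner product on $\mathbb{R}^N$. Stationarity: $X$ is stationary if for every $s\in\mathbb{Z}^N$ the fields $(X_{t+s})_{t\in\mathbb{Z}^N}$ and $(X_t)_{t\in\mathbb{Z}^N}$ have the same finite dimensional distributions. Increments: for a field $X$ and $t=(t_1,\dots,t_N)\in\mathbb{Z}^N$, $$\Delta_tX=\sum_{(i_1,\dots,i_N)\in\{0,1\}^N}(-1)^{\sum_{l=1}^Ni_l}X_{t_1-i_1,\dots,t_N-i_N}.$$ A field $X$ is a stationary increment field (has stationary increments) if the field $(\Delta_tX)_{t\in\mathbb{Z}^N}$ is stationary. The notation $\langle\hat\Theta,\hat X_t^-\rangle$: for $\Theta=(\theta_1,\dots,\theta_N)\in(0,\infty)^N$ and a field $X$, $$\langle\hat\Theta,\hat X_t^-\rangle=\sum_{i=(i_1,\dots,i_N)\in\{0,1\}^N,\ i\ne\mathbf{0}}(-1)^{1+\sum_{l=1}^Ni_l}e^{-\langle i,\Theta\rangle}X_{t_1-i_1,\dots,t_N-i_N}.$$ Class $\mathcal{G}_\Theta$: a random field $G=(G_t)_{t\in\mathbb{Z}^N}$ belongs to $\mathcal{G}_\Theta$ if $G$ is a stationary increment field, $G_t=0$ for all $t$ with $\sum_{l=1}^Nt_l\in\{0,-1,\dots,-N+1\}$, and for every $t=(t_1,\dots,t_N)\in\mathbb{Z}^N$ the iterated limit $$\lim_{M_1\to\infty}\cdots\lim_{M_N\to\infty}\sum_{j_1=-M_1}^{t_1}\cdots\sum_{j_N=-M_N}^{t_N}e^{\sum_{l=1}^Nj_l\theta_l}\Delta_{(j_1,\dots,j_N)}G$$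 (limits taken in probability, $M_N\to\infty$ first) exists and defines an almost surely finite random variable. *)

(* Defs.v *)
From HB Require Import structures.
From mathcomp Require Import all_boot all_order all_algebra.
From mathcomp Require Import all_classical all_reals all_analysis.

Set Implicit Arguments.
Unset Strict Implicit.
Unset Printing Implicit Defensive.

Import Order.TTheory GRing.Theory Num.Theory.
Import numFieldNormedType.Exports.

Local Open Scope classical_set_scope.
Local Open Scope ring_scope.

(* Random variables are identified up to almost sure equality, as convergence
   in probability requires: every equation between random variables below is
   an equality [%[ae P]]. *)

Section RandomFields.
Context {R : realType} {d : measure_display} {T : measurableType d}.
Variable P : probability T R.

Definition same_fdd (I : Type) (X Y : I -> {RV P >-> R}) : Prop :=
  forall (n : nat) (t : n.-tuple I) (B : set (n.-tuple R)), measurable B ->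
    pushforward P (fun w => map_tuple (fun s => X s w) t) B =
    pushforward P (fun w => map_tuple (fun s => Y s w) t) B.

Definition cvg_in_prob (Y : nat -> {RV P >-> R}) (L : {RV P >-> R}) : Prop :=
  forall eps : R, 0 < eps ->
    P [set w | eps <= `|Y n w - L w|] @[n --> \oo] --> 0%E.

(* [iter_lim S L] states that the iterated limit in probability
   lim_(M_1) ... lim_(M_n) S(M_1, ..., M_n) exists and equals L. The head of
   the tuple is the outermost index. *)
Fixpoint iter_lim (n : nat) :
    (n.-tuple nat -> {RV P >-> R}) -> {RV P >-> R} -> Prop :=
  match n with
  | 0 => fun S L => S [tuple] = L %[ae P]
  | n'.+1 => fun S L => exists2 L' : nat -> {RV P >-> R},
      (forall m, iter_lim (fun M : n'.-tuple nat => S [tuple of m :: M]) (L' m))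
      & cvg_in_prob L' L
  end.

Variable N : nat.
Implicit Types (t : 'rV[int]_N) (i : {ffun 'I_N -> bool}).
Implicit Types (Theta : 'rV[R]_N) (X G : 'rV[int]_N -> {RV P >-> R}).

Definition stationary X : Prop :=
  forall s, same_fdd (fun t => X (t + s)) X.

Definition inner t Theta : R := \sum_l (t 0 l)%:~R * Theta 0 l.

(* Elements of {0,1}^N are functions i : 'I_N -> bool. *)
Definition corner i : 'rV[int]_N := \row_l (i l : nat)%:Z.

Definition incr X t : {RV P >-> R} :=
  \sum_(i : {ffun 'I_N -> bool}) (-1) ^+ (\sum_l i l)%N *: X (t - corner i).

Definition stationary_increments X : Prop := stationary (incr X).

Definition lag_comb Theta X t : {RV P >-> R} :=
  \sum_(i : {ffun 'I_N -> bool} | i != [ffun=> false])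
    ((-1) ^+ (1 + \sum_l i l)%N * expR (- inner (corner i) Theta))
      *: X (t - corner i).

(* The index set of the sum over -M_l <= j_l <= t_l; it is finite, and empty
   as soon as t_l < -M_l for some l. *)
Definition box t (M : N.-tuple nat) : set 'rV[int]_N :=
  [set j | forall l, - (tnth M l)%:Z <= j 0 l <= t 0 l].

Definition class_G Theta G : Prop :=
  [/\ stationary_increments G,
      (forall t, - N%:Z + 1 <= \sum_l t 0 l <= 0 -> G t = cst 0 %[ae P])
    & (forall t, exists L : {RV P >-> R},
        iter_lim (fun M => \sum_(j \in box t M) expR (inner j Theta) *: incr G j)
          L)].

Definition set_coord t (j : 'I_N) (m : int) : 'rV[int]_N :=
  \row_l (if l == j then m else t 0 l).

(* m -> -oo in Z is written m = - k, with k -> oo in nat. *)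
Definition decay Theta X : Prop :=
  forall (j : 'I_N) t,
    cvg_in_prob
      (fun k : nat => expR ((- k%:Z)%:~R * Theta 0 j) *: X (set_coord t j (- k%:Z)))
      (cst 0).

Definition AR_rep Theta X G : Prop :=
  forall t, X t = lag_comb Theta X t \+ incr G t %[ae P].

End RandomFields.

(* Main.v *)
(* With the discounted field Y t = e^<t,Theta> X t, the autoregressive equation
   reads e^<t,Theta> Delta_t G = Delta_t Y.  Summing over a box telescopes, one
   coordinate at a time, to an alternating sum of values of Y at the corners of
   the box; the corners other than t lie far out along some axis, so the decay
   condition kills them in the iterated limit, which is therefore Y t.
   If X is stationary, the decay is immediate and G is obtained by solving
   Delta G = e^(-<t,Theta>) Delta Y by recursion on t_1 + ... + t_N, upwards and
   downwards from the strip where G vanishes; the same recursion gives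
   uniqueness.  Conversely, for fixed bounds the box sums of
   e^<j,Theta> Delta_(j+s) G have a law that does not depend on s, and equality
   of laws passes to limits in probability, taken one coordinate at a time. *)

Require Import Defs.
From HB Require Import structures.
From mathcomp Require Import all_boot all_order all_algebra.
From mathcomp Require Import all_classical all_reals all_analysis.
From mathcomp Require Import zify lra.

Set Implicit Arguments.
Unset Strict Implicit.
Unset Printing Implicit Defensive.

Import Order.TTheory GRing.Theory Num.Theory.
Import numFieldNormedType.Exports.

Local Open Scope classical_set_scope.
Local Open Scope ring_scope.

(** * Coordinatewise differences and telescoping *)

Section CoordinateUpdates.
Context (N : nat).
Implicit Types (t : 'rV[int]_N) (l : 'I_N) (v : int).

Lemma set_coordE t l v i : set_coord t l v 0 i = if i == l then v else t 0 i.
Proof. by rewrite mxE. Qed.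

Lemma set_coord_same t l v : set_coord t l v 0 l = v.
Proof. by rewrite set_coordE eqxx. Qed.

Lemma set_coord_neq t l l' v : l != l' -> set_coord t l v 0 l' = t 0 l'.
Proof. by move=> ll'; rewrite set_coordE eq_sym (negPf ll'). Qed.

Lemma set_coord_id t l : set_coord t l (t 0 l) = t.
Proof. by apply/rowP => i; rewrite set_coordE; case: eqP => // ->. Qed.

Lemma set_coord_twice t l v v' :
  set_coord (set_coord t l v) l v' = set_coord t l v'.
Proof. by apply/rowP => i; rewrite !set_coordE; case: eqP. Qed.

Lemma set_coordC t l l' v v' : l != l' ->
  set_coord (set_coord t l v) l' v' = set_coord (set_coord t l' v') l v.
Proof.
move=> ll'; apply/rowP => i; rewrite !set_coordE.
by case: eqP => // ->; rewrite eq_sym (negPf ll').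
Qed.

End CoordinateUpdates.

(** * Iterated sums over finite products *)

Section IteratedSums.
Context (I : finType) (K : eqType) (V : nmodType).
Implicit Types (r : I -> seq K) (f g : {ffun I -> K}) (s : seq I).

Definition upd f l v : {ffun I -> K} := [ffun i => if i == l then v else f i].

(** Recursion along [s] lets a sum over a product be peeled one coordinate at a time; coordinates
    outside [s] keep their value in [f]. *)
Fixpoint prods r s f : seq {ffun I -> K} :=
  if s is l :: s' then flatten [seq prods r s' (upd f l v) | v <- r l]
  else [:: f].

Fixpoint itsum r s (F : {ffun I -> K} -> V) f : V :=
  if s is l :: s' then \sum_(v <- r l) itsum r s' F (upd f l v) else F f.

Lemma itsumE r s F f : itsum r s F f = \sum_(g <- prods r s f) F g.
Proof.
elim: s f => [|l s IHs] f /=; first by rewrite big_seq1.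
by rewrite big_flatten big_map; apply: eq_bigr => v _.
Qed.

Lemma mem_prods r s f g : uniq s ->
  (g \in prods r s f) = [forall l, if l \in s then g l \in r l else g l == f l].
Proof.
elim: s f => [|l s IHs] f /=.
  move=> _; rewrite inE; apply/eqP/forallP => [-> //|gf].
  by apply/ffunP => l; apply/eqP/gf.
case/andP=> lNs us; apply/flatten_mapP/forallP => [[v vr]|gr].
  rewrite IHs// => /forallP gr i; rewrite inE.
  have := gr i; rewrite ffunE; case: (eqVneq i l) => //= ->.
  by rewrite (negPf lNs) => /eqP ->.
exists (g l); first by have := gr l; rewrite inE eqxx.
rewrite IHs//; apply/forallP => i; have := gr i; rewrite inE ffunE.
by case: (eqVneq i l) => //= ->; rewrite (negPf lNs) eqxx.
Qed.

Lemma prods_uniq r s f : uniq s -> (forall l, uniq (r l)) -> uniq (prods r s f).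
Proof.
move=> + ur; elim: s f => //= l s IHs f /andP[lNs us].
have : uniq (r l) by exact: ur.
elim: (r l) => //= v rl IHr /andP[vNr url].
rewrite cat_uniq IHs// IHr// andbT; apply/hasPn => g /flatten_mapP[w wr].
rewrite /= !mem_prods// => /forallP/(_ l) + ; rewrite (negPf lNs) ffunE eqxx.
move=> /eqP gw; apply/negP => /forallP/(_ l); rewrite (negPf lNs) ffunE eqxx gw.
by move=> /eqP wv; rewrite -wv wr in vNr.
Qed.

End IteratedSums.

(** * One-coordinate differences and multidimensional telescoping *)

Section IteratedDifferences.
Context (N : nat) (R : pzRingType) (V : lmodType R).
Implicit Types (t : 'rV[int]_N) (l : 'I_N) (Y W : 'rV[int]_N -> V) (m : nat).

(** The increment over an arbitrary module, which keeps the combinatorics free of probability. *)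
Definition nincr Y t : V :=
  \sum_(i : {ffun 'I_N -> bool}) (-1) ^+ (\sum_l i l)%N *: Y (t - corner i).

(* The segment [-m, b], empty when b < -m. *)
Definition segment m (b : int) : seq int :=
  [seq - m%:Z + k%:Z | k <- iota 0 (absz (Num.max 0 (b + m%:Z + 1)))].

Lemma mem_segment m b v : (v \in segment m b) = (- m%:Z <= v <= b).
Proof.
apply/mapP/idP => [[k]|vb]; first by rewrite mem_iota => kb ->; lia.
by exists (absz (v + m%:Z)); [rewrite mem_iota; lia|lia].
Qed.

Lemma segment_uniq m b : uniq (segment m b).
Proof. by rewrite map_inj_uniq ?iota_uniq// => i j; lia. Qed.

Definition diff1 l Y t : V := Y t - Y (set_coord t l (t 0 l - 1)).

Definition sum1 (M : 'I_N -> nat) l W t : V :=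
  \sum_(v <- segment (M l) (t 0 l)) W (set_coord t l v).

(* Thanks to the [min], [sum1_diff1] below also covers empty segments. *)
Definition tele1 m l W t : V :=
  W t - W (set_coord t l (Num.min (t 0 l) (- m%:Z - 1))).

Definition tele (s : seq ('I_N * nat)) W : 'rV[int]_N -> V :=
  foldr (fun p => tele1 p.2 p.1) W s.

Lemma sum1_diff1 M l Y t : sum1 M l (diff1 l Y) t = tele1 (M l) l Y t.
Proof.
rewrite /sum1 /tele1; set m := M l; rewrite -[X in _ = Y X - _](set_coord_id t l).
have -> : \sum_(v <- segment m (t 0 l)) diff1 l Y (set_coord t l v) =
    \sum_(v <- segment m (t 0 l)) (Y (set_coord t l v) - Y (set_coord t l (v - 1))).
  by apply: eq_bigr => v _; rewrite /diff1 set_coord_same set_coord_twice.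
rewrite /segment big_map.
have [tm|tm] := lerP (t 0 l) (- m%:Z - 1).
  have -> : Num.max 0 (t 0 l + m%:Z + 1) = 0 by lia.
  by rewrite big_nil subrr.
set n := absz _.
(* The segment is nonempty with [n] points, so [t 0 l] is [n] steps above the lower corner [-m - 1];
   induction on [n]. *)
have -> : t 0 l = - m%:Z - 1 + n%:Z by lia.
elim: n {tm} => [|n IHn]; first by rewrite big_nil addr0 subrr.
rewrite -[in iota _ _]addn1 iotaD big_cat IHn big_seq1 add0n.
have -> : - m%:Z + n%:Z - 1 = - m%:Z - 1 + n%:Z by lia.
have -> : - m%:Z - 1 + n.+1%:Z = - m%:Z + n%:Z by lia.
by rewrite [LHS]addrC addrA subrK.
Qed.

Lemma diff1_sum1 M l l' W : l != l' ->
  diff1 l (sum1 M l' W) = sum1 M l' (diff1 l W).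
Proof.
move=> ll'; apply/funext => t; rewrite /diff1 /sum1 set_coord_neq// sumrB.
congr (_ - _); apply: eq_bigr => v _.
by rewrite set_coord_neq 1?eq_sym// set_coordC.
Qed.

Lemma tele1C m m' l l' W : l != l' ->
  tele1 m l (tele1 m' l' W) = tele1 m' l' (tele1 m l W).
Proof.
move=> ll'; have l'l : l' != l by rewrite eq_sym.
apply/funext => t; rewrite /tele1 !set_coord_neq// (set_coordC _ _ _ ll').
by rewrite !opprD !opprK !addrA; congr (_ + _); rewrite addrAC.
Qed.

(** Moves the outermost coordinate next to [W], so that fixing its bound merely replaces [W] by
    another field in the inductions on coordinates. *)
Lemma tele1_tele m l (s : seq ('I_N * nat)) W : l \notin map fst s ->
  tele1 m l (tele s W) = tele s (tele1 m l W).
Proof.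
elim: s => [//|p s IHs] /=; rewrite inE negb_or => /andP[lp lNs].
by rewrite tele1C// IHs.
Qed.

Lemma nincrE Y t : nincr Y t = foldr diff1 Y (enum 'I_N) t.
Proof.
have uN := enum_uniq 'I_N.
pose F (i : {ffun 'I_N -> bool}) := (-1) ^+ (\sum_l i l)%N *: Y (t - corner i).
have -> : nincr Y t =
    itsum (fun=> [:: false; true]) (enum 'I_N) F [ffun=> false].
  rewrite itsumE; apply: perm_big; apply: uniq_perm.
  - exact: index_enum_uniq.
  - exact: prods_uniq.
  - move=> i; rewrite mem_index_enum mem_prods//; apply/esym/forallP => l.
    by rewrite mem_enum /=; case: (i l).
(* Generalised for induction: [f] records the coordinates already chosen, and those still in [s] are
   at [false]. Choosing [true] at [l] costs one sign and one unit step down in coordinate [l]. *)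
have F0 (f : {ffun 'I_N -> bool}) (s : seq 'I_N) :
    uniq s -> (forall l, l \in s -> f l = false) ->
    itsum (fun=> [:: false; true]) s F f =
    (-1) ^+ (\sum_l f l)%N *: foldr diff1 Y s (t - corner f).
  elim: s f => [//|l s IHs] f /= /andP[lNs us] fs.
  have upds b i : i \in s -> upd f l b i = false.
    move=> si; rewrite ffunE; case: eqP => [il|_].
      by rewrite -il si in lNs.
    by rewrite fs// inE si orbT.
  have updf : upd f l false = f.
    by apply/ffunP => i; rewrite ffunE; case: eqP => // ->; rewrite fs// mem_head.
  have sumt : (\sum_i upd f l true i = (\sum_i f i).+1)%N.
    rewrite (bigD1 l)//= ffunE eqxx [in RHS](bigD1 l)//= fs ?mem_head//.
    rewrite add0n add1n; congr (_.+1); apply: eq_bigr => i il.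
    by rewrite ffunE (negPf il).
  have IHb b : itsum (fun=> [:: false; true]) s F (upd f l b) =
      (-1) ^+ (\sum_i upd f l b i)%N *: foldr diff1 Y s (t - corner (upd f l b)).
    by apply: IHs => // i; exact: upds.
  rewrite big_cons big_seq1 !IHb updf.
  have -> : t - corner (upd f l true) =
      set_coord (t - corner f) l ((t - corner f) 0 l - 1).
    apply/rowP => i; rewrite set_coordE !mxE ffunE.
    by case: eqP => // ->; rewrite fs ?mem_head//; lia.
  by rewrite sumt exprS mulN1r scaleNr /diff1 scalerBr.
rewrite F0//; last by move=> l _; rewrite ffunE.
rewrite big1 ?expr0 ?scale1r; last by move=> l _; rewrite ffunE.
by congr (foldr _ _ _ _); apply/rowP => l; rewrite !mxE ffunE subr0.
Qed.

(** A difference in [l] passes through the sums over the other coordinates, so each sum meets its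
    own difference and telescopes. *)
Lemma sum_foldr_diff1 M s Y : uniq s ->
  foldr (sum1 M) (foldr diff1 Y s) s = tele [seq (l, M l) | l <- s] Y.
Proof.
elim: s => //= l s IHs /andP[lNs us].
rewrite -IHs//.
have -> : foldr (sum1 M) (diff1 l (foldr diff1 Y s)) s =
          diff1 l (foldr (sum1 M) (foldr diff1 Y s) s).
  elim: s lNs {IHs us} (foldr diff1 Y s) => //= l' s IHs.
  rewrite inE negb_or => /andP[ll' lNs] Z.
  by rewrite IHs// diff1_sum1.
by apply/funext => t; rewrite sum1_diff1.
Qed.

Definition box_seq t (M : N.-tuple nat) : seq 'rV[int]_N :=
  [seq \row_l (g : {ffun _}) l
    | g <- prods (fun l => segment (tnth M l) (t 0 l)) (enum 'I_N)
                 [ffun l => t 0 l]].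

Lemma box_seq_uniq t M : uniq (box_seq t M).
Proof.
rewrite map_inj_uniq; last first.
  by move=> f g /rowP fg; apply/ffunP => l; have := fg l; rewrite !mxE.
by apply: prods_uniq (enum_uniq _) _ => l; exact: segment_uniq.
Qed.

Lemma box_seqE t M : [set` box_seq t M] = box t M.
Proof.
apply/seteqP; split=> j /=.
  case/mapP => g; rewrite mem_prods ?enum_uniq// => /forallP gb -> l.
  by have := gb l; rewrite mem_enum mem_segment mxE.
move=> jb; apply/mapP; exists [ffun l => j 0 l].
  rewrite mem_prods ?enum_uniq//; apply/forallP => l.
  by rewrite mem_enum mem_segment ffunE; exact: jb.
by apply/rowP => l; rewrite mxE ffunE.
Qed.

Lemma sum_box_seq t M W :
  \sum_(j <- box_seq t M) W j = foldr (sum1 (tnth M)) W (enum 'I_N) t.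
Proof.
rewrite /box_seq big_map -(itsumE _ _ (fun g : {ffun 'I_N -> int} => W (\row_l g l))).
(* As in [nincrE], [f] carries the coordinates already chosen; it must agree with [t] on [s], since
   [t] bounds the remaining segments from above. *)
have F0 (f : {ffun 'I_N -> int}) (s : seq 'I_N) :
    uniq s -> (forall l, l \in s -> f l = t 0 l) ->
    itsum (fun l => segment (tnth M l) (t 0 l)) s
      (fun g : {ffun 'I_N -> int} => W (\row_l g l)) f =
    foldr (sum1 (tnth M)) W s (\row_l f l).
  elim: s f => [//|l s IHs] f /= /andP[lNs us] fs.
  rewrite /sum1 mxE fs ?mem_head//; apply: eq_bigr => v _.
  rewrite IHs//; last first.
    move=> i si; rewrite ffunE; case: eqP => [il|_]; first by rewrite -il si in lNs.
    by rewrite fs// inE si orbT.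
  by congr (foldr _ _ _ _); apply/rowP => i; rewrite set_coordE !mxE ffunE.
rewrite F0 ?enum_uniq//; last by move=> l _; rewrite ffunE.
by congr (foldr _ _ _ _); apply/rowP => l; rewrite !mxE ffunE.
Qed.

Lemma sum_box_nincr t M Y :
  \sum_(j <- box_seq t M) nincr Y j = tele (zip (enum 'I_N) M) Y t.
Proof.
have -> : nincr Y = foldr diff1 Y (enum 'I_N) by apply/funext => j; exact: nincrE.
rewrite sum_box_seq sum_foldr_diff1 ?enum_uniq//; congr (tele _ _ _).
by rewrite -[in RHS](map_tnth_enum M) -{2}(map_id (enum 'I_N)) zip_map.
Qed.

End IteratedDifferences.

(** * The increment equation *)

Section IncrementEquation.
Context (N : nat) (R : pzRingType) (V : lmodType R).
Implicit Types (t : 'rV[int]_N) (i : {ffun 'I_N -> bool}) (D G Z : 'rV[int]_N -> V).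

(** The level in the recursion: [nincr D t] involves levels from [height t - N] to [height t], and
    each extreme level is attained by a single corner. *)
Definition height t : int := \sum_l t 0 l.

Lemma height_lag t i : height (t - corner i) = height t - (\sum_l i l)%N%:Z.
Proof.
rewrite /height (big_morph Posz PoszD (erefl 0%:Z)) -sumrB.
by apply: eq_bigr => l _; rewrite !mxE.
Qed.

Lemma corner_height_le i : (\sum_l i l <= N)%N.
Proof.
rewrite -[leqRHS]card_ord -sum1_card; apply: leq_sum => l _; exact: leq_b1.
Qed.

Lemma corner_height_gt0 i : i != [ffun=> false] -> (0 < \sum_l i l)%N.
Proof.
apply: contraNT; rewrite -eqn0Ngt sum_nat_eq0 => /forall_inP i0.
by apply/eqP/ffunP => l; rewrite ffunE; have := i0 l isT; case: (i l).
Qed.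

Lemma corner_height_lt i : i != [ffun=> true] -> (\sum_l i l < N)%N.
Proof.
apply: contraNT; rewrite -leqNgt => Ni; apply/eqP/ffunP => l; rewrite ffunE.
apply: contraTT Ni => il; rewrite -ltnNge (bigD1 l)//= (negPf il) add0n.
rewrite -[ltnRHS]card_ord (cardD1 l) inE/= add1n ltnS -sum1_card.
rewrite [leqRHS](eq_bigl (fun k => k != l)); last by move=> k; rewrite !inE andbT.
by apply: leq_sum => k _; exact: leq_b1.
Qed.

Lemma nincr_top D t : nincr D t = D t +
  \sum_(i | i != [ffun=> false]) (-1) ^+ (\sum_l i l)%N *: D (t - corner i).
Proof.
rewrite /nincr (bigD1 [ffun=> false])//= big1 ?scale1r//; last first.
  by move=> l _; rewrite ffunE.
by congr (D _ + _); apply/rowP => l; rewrite !mxE ffunE subr0.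
Qed.

(** The shift by the all-ones vector makes [t] the unique lowest point of the increment. *)
Lemma nincr_bot D t : nincr D (t + const_mx 1) = (-1) ^+ N *: D t +
  \sum_(i | i != [ffun=> true])
    (-1) ^+ (\sum_l i l)%N *: D (t + const_mx 1 - corner i).
Proof.
rewrite /nincr (bigD1 [ffun=> true])//=.
have -> : (\sum_(l < N) [ffun=> true] l = N)%N.
  by rewrite (eq_bigr (fun=> 1%N)) => [|l _]; rewrite ?sum1_card ?card_ord ?ffunE.
by congr (_ *: D _ + _); apply/rowP => l; rewrite !mxE ffunE addrK.
Qed.

Lemma height_shift1 t : height (t + const_mx 1) = height t + N%:Z.
Proof.
rewrite /height -[in N%:Z](card_ord N) -sum1_card.
rewrite (big_morph Posz PoszD (erefl 0%:Z)) -big_split.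
by apply: eq_bigr => l _; rewrite !mxE.
Qed.

(* Both directions of the recursion: [nincr D] determines [D] at the largest
   height from the N heights below, and at the smallest one from the N heights
   above. *)
Lemma nincr_determines (E : V -> Prop) D : (0 < N)%N ->
  (forall x y, E x -> E y -> E (x + y)) -> (forall a x, E x -> E (a *: x)) ->
  E 0 -> (forall t, E (nincr D t)) ->
  (forall t, - N%:Z + 1 <= height t <= 0 -> E (D t)) -> forall t, E (D t).
Proof.
move=> N0 ED EZ E0 Einc Estrip t.
have Esum (p : pred {ffun 'I_N -> bool}) (F : {ffun 'I_N -> bool} -> V) :
    (forall i, p i -> E (F i)) -> E (\sum_(i | p i) F i).
  by move=> EF; elim/big_ind : _.
have EB x y : E (x + y) -> E y -> E x.
  move=> Exy Ey; rewrite -(addrK y x) -scaleN1r; apply: ED => //; exact: EZ.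
(* The strip is widened by one level at each end per induction step. *)
suff H (n : nat) s : - N%:Z + 1 - n%:Z <= height s <= n%:Z -> E (D s).
  by apply: (H (absz (height t))); lia.
elim: n s => [|n IHn] s sn; first by apply: Estrip; lia.
have [sn'|] := boolP (- N%:Z + 1 - n%:Z <= height s <= n%:Z); first exact: IHn.
have [s_top _|s_ntop s_out] := boolP (height s == n.+1%:Z).
  have := Einc s; rewrite nincr_top => /EB; apply; apply: Esum => i i0.
  apply/EZ/IHn; rewrite height_lag.
  by have := corner_height_gt0 i0; have := corner_height_le i; lia.
(* The only level left is [-N - n], just below the known band. *)
have := Einc (s + const_mx 1); rewrite nincr_bot => /EB Es.
rewrite -[D s]scale1r -(expr0 (-1)) -[0%N](subnn N).
have -> : (-1) ^+ (N - N) = (-1) ^+ N * (-1) ^+ N :> R.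
  by rewrite subnn expr0 -exprD addnn -mul2n exprM sqrrN expr1n expr1n.
rewrite -scalerA; apply/EZ/Es; apply: Esum => i i1.
apply/EZ/IHn; rewrite height_lag height_shift1.
by have := corner_height_lt i1; lia.
Qed.

(** Solves [nincr D = Z] with [D = 0] on the strip, for heights from [-N + 1 - n] to [n]. The fuel
    [n] makes the two-sided recursion structural: each unit adds the levels [n] and [-N + 1 - n]. *)
Fixpoint antincr_upto Z (n : nat) t : V :=
  if n is n'.+1 then
    if height t == n'.+1%:Z then
      Z t - \sum_(i | i != [ffun=> false])
              (-1) ^+ (\sum_l i l)%N *: antincr_upto Z n' (t - corner i)
    else if height t == - N%:Z - n'%:Z then
      (-1) ^+ N *: (Z (t + const_mx 1) - \sum_(i | i != [ffun=> true])
        (-1) ^+ (\sum_l i l)%N *: antincr_upto Z n' (t + const_mx 1 - corner i))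
    else antincr_upto Z n' t
  else 0.

Definition antincr Z t : V := antincr_upto Z (absz (height t)) t.

(** Extra fuel only alters levels outside the band already reached, and [absz (height t)] is enough
    fuel for [t] because [N] is positive. *)
Lemma antincr_uptoE Z n t : (0 < N)%N ->
  - N%:Z + 1 - n%:Z <= height t <= n%:Z -> antincr_upto Z n t = antincr Z t.
Proof.
move=> N0 tn; rewrite /antincr; set k := absz _.
have H (a b : nat) : - N%:Z + 1 - a%:Z <= height t <= a%:Z ->
    antincr_upto Z (b + a) t = antincr_upto Z a t.
  move=> ta; elim: b => // b IHb; rewrite addSn /=.
  by rewrite !ifF ?IHb//; apply/negbTE; lia.
case: (leqP k n) => kn; first by rewrite -(subnK kn) H//; lia.
by rewrite -(subnK (ltnW kn)) H.
Qed.

Lemma antincr_strip Z t : (0 < N)%N ->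
  - N%:Z + 1 <= height t <= 0 -> antincr Z t = 0.
Proof. by move=> N0 th; rewrite -(@antincr_uptoE Z 0)//; lia. Qed.

(** At positive height the equation is the one that defined the value at [t]; at height [-n] it is
    the one that defined the value at the opposite corner, of height [-N - n]. *)
Lemma nincr_antincr Z t : (0 < N)%N -> nincr (antincr Z) t = Z t.
Proof.
move=> N0; case: (boolP (0 < height t)) => th.
  have [n tn] : exists n : nat, height t = n.+1%:Z.
    by exists (absz (height t)).-1; lia.
  rewrite nincr_top -(@antincr_uptoE Z n.+1)//=; last by lia.
  rewrite tn eqxx -[RHS]addr0 -addrA; congr (_ + _).
  rewrite addrC; apply/eqP; rewrite subr_eq0; apply/eqP.
  apply: eq_bigr => i i0; congr (_ *: _); rewrite (@antincr_uptoE Z n)// height_lag.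
  by have := corner_height_gt0 i0; have := corner_height_le i; lia.
have [n tn] : exists n : nat, height t = - n%:Z.
  by exists (absz (height t)); lia.
have [s ts] : exists s, t = s + const_mx 1 by exists (t - const_mx 1); rewrite subrK.
have sn : height s = - N%:Z - n%:Z by move: tn; rewrite ts height_shift1; lia.
rewrite ts nincr_bot -(@antincr_uptoE Z n.+1 s)//=; last by lia.
rewrite sn ifF; last by apply/negbTE; lia.
rewrite eqxx scalerA -exprD addnn -mul2n exprM sqrrN expr1n expr1n scale1r.
rewrite -[RHS]addr0 -addrA; congr (_ + _).
rewrite addrC; apply/eqP; rewrite subr_eq0; apply/eqP.
apply: eq_bigr => i i1; congr (_ *: _); rewrite (@antincr_uptoE Z n)//.
rewrite height_lag height_shift1 sn.
by have := corner_height_lt i1; lia.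
Qed.

End IncrementEquation.

(** * Convergence in probability *)

Section ConvergenceInProbability.
Context {R : realType} {d : measure_display} {T : measurableType d}.
Context (P : probability T R).

(* The module structure of random variables is not inferred from
   [{RV P >-> R}], whence the casts to [rv]. *)
Definition rv : lmodType R := {mfun T >-> R}.

Implicit Types (X Y Z L : {RV P >-> R}) (U V : nat -> {RV P >-> R}).

Lemma rv_ext (X Y : rv) :
  (X : {mfun T >-> R}) =1 (Y : {mfun T >-> R}) -> X = Y.
Proof. by move=> XY; apply/mfuneqP. Qed.

Lemma rv_sumE (I : Type) (s : seq I) (p : pred I) (F : I -> rv) w :
  (\sum_(i <- s | p i) F i : rv) w = \sum_(i <- s | p i) F i w.
Proof. exact: (big_morph (fun X : rv => X w)). Qed.

Lemma measurable_dist_ge Y L (eps : R) :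
  measurable [set w | eps <= `|Y w - L w|].
Proof.
rewrite -[X in measurable X]setTI.
have : measurable_fun setT (fun w => eps <= `|Y w - L w|).
  apply: measurable_realfun.measurable_fun_ler => //.
  apply: measurableT_comp => //; exact: measurable_realfun.measurable_funB.
by move=> /(_ measurableT [set true] I).
Qed.

Lemma cvg_in_probP U L : cvg_in_prob U L <->
  forall eps del : R, 0 < eps -> 0 < del ->
    \forall n \near \oo, (P [set w | (eps <= `|U n w - L w|)%R] < del%:E)%E.
Proof.
have Pfin eps n : P [set w | eps <= `|U n w - L w|] \is a fin_num.
  exact/fin_num_measure/measurable_dist_ge.
split=> [UL eps del eps0 del0|UL eps eps0].
  have /fine_cvgP[_ /cvgr0Pnorm_lt/(_ _ del0)] := UL _ eps0.
  apply: filterS => n /=; rewrite ger0_norm ?fine_ge0 ?measure_ge0//.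
  by rewrite -lte_fin fineK.
apply/fine_cvgP; split; first by apply: nearW => n.
apply/cvgr0Pnorm_lt => del del0; have := UL eps del eps0 del0.
apply: filterS => n /=; rewrite ger0_norm ?fine_ge0 ?measure_ge0//.
by rewrite -lte_fin fineK.
Qed.

Lemma cvg_in_prob_near U V L : (\forall n \near \oo, U n = V n) ->
  cvg_in_prob V L -> cvg_in_prob U L.
Proof.
move=> UV /cvg_in_probP VL; apply/cvg_in_probP => eps del eps0 del0.
by apply: filterS2 UV (VL eps del eps0 del0) => n ->.
Qed.

Lemma cvg_in_prob_comp U L (phi : nat -> nat) :
  phi n @[n --> \oo] --> \oo -> cvg_in_prob U L -> cvg_in_prob (U \o phi) L.
Proof. by move=> phioo UL eps eps0; exact: cvg_comp phioo (UL eps eps0). Qed.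

Lemma cvg_in_prob_ae X L : X = L %[ae P] -> cvg_in_prob (fun=> X) L.
Proof.
move=> XL; apply/cvg_in_probP => eps del eps0 del0; apply: nearW => n.
suff -> : P [set w | eps <= `|X w - L w|] = 0%E by rewrite lte_fin.
apply/negligibleP; first exact: measurable_dist_ge.
apply: negligibleS XL => w /= + XLw.
by rewrite XLw// subrr normr0 leNgt eps0.
Qed.

Lemma cvg_in_probB U V X Y : cvg_in_prob U X -> cvg_in_prob V Y ->
  cvg_in_prob (P := P) (fun n => (U n : rv) - (V n : rv)) ((X : rv) - (Y : rv)).
Proof.
move=> /cvg_in_probP UX /cvg_in_probP VY.
apply/cvg_in_probP => eps del eps0 del0.
have eps20 : 0 < eps / 2 by rewrite divr_gt0.
have del20 : 0 < del / 2 by rewrite divr_gt0.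
apply: filterS2 (UX _ _ eps20 del20) (VY _ _ eps20 del20) => n Un Vn.
rewrite [del]splitr EFinD; apply: le_lt_trans (lteD Un Vn).
apply: le_trans (measureU2 _ _ _); try exact: measurable_dist_ge.
apply: le_measure; rewrite ?inE; first exact: measurable_dist_ge.
  by apply: measurableU; exact: measurable_dist_ge.
move=> w /=; case: (lerP (eps / 2) `|U n w - X w|) => [|Uw]; first by left.
case: (lerP (eps / 2) `|V n w - Y w|) => [|Vw]; first by right.
rewrite leNgt => /negP[]; rewrite [eps]splitr.
apply: le_lt_trans (ltrD Uw Vw).
rewrite -[X in `|X| <= _]/((U n w - V n w) - (X w - Y w)).
by rewrite opprD addrACA -opprD; apply: ler_normB.
Qed.

Lemma cvg_in_probZ U X (a : R) : cvg_in_prob U X ->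
  cvg_in_prob (P := P) (fun n => a *: (U n : rv)) (a *: (X : rv)).
Proof.
move=> /cvg_in_probP UX; apply/cvg_in_probP => eps del eps0 del0.
(* Dividing by [|a| + 1] instead of [|a|] covers [a = 0] as well. *)
have b0 : 0 < `|a| + 1 by rewrite ltr_wpDl.
have epsb : 0 < eps / (`|a| + 1) by rewrite divr_gt0.
apply: filterS (UX _ _ epsb del0) => n; apply: le_lt_trans.
apply: le_measure; rewrite ?inE; try exact: measurable_dist_ge.
move=> w /= epsw; rewrite ler_pdivrMr//; apply: le_trans epsw _.
rewrite -[X in X <= _]/(`|a * U n w - a * X w|) -mulrBr normrM mulrC.
by rewrite ler_wpM2l// lerDl.
Qed.

End ConvergenceInProbability.

(** * Finite-dimensional laws *)

Section FiniteDimensionalLaws.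
Context {R : realType} {d : measure_display} {T : measurableType d}.
Context (P : probability T R).

(** Open lower orthants form a pi-system generating the product sigma-algebra, and each is an
    increasing union of smaller ones, which suits limits in probability. *)
Definition orthant n (c : 'I_n -> R) : set (n.-tuple R) :=
  [set x | forall k, tnth x k < c k].

Lemma measurable_tnth_lt n (c : R) (k : 'I_n) :
  measurable [set x : n.-tuple R | tnth x k < c].
Proof.
rewrite (_ : mkset _ = (fun x : n.-tuple R => tnth x k) @^-1` `]-oo, c[).
  rewrite -[X in measurable X]setTI; apply: (measurable_tnth k) => //.
by apply/seteqP; split=> x /=; rewrite in_itv.
Qed.

Lemma measurable_orthant n (c : 'I_n -> R) : measurable (orthant c).
Proof.
rewrite (_ : orthant c = \bigcap_(k in [set: 'I_n]) [set x | tnth x k < c k]).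
  apply: fin_bigcap_measurable => [|k _]; first exact: finite_finset.
  exact: measurable_tnth_lt.
by apply/seteqP; split=> x /= xc k; [move=> _|]; exact: xc.
Qed.

Lemma tuple_nat_gt n (x : n.-tuple R) : exists m : nat, orthant (fun=> m%:R) x.
Proof.
have [m _ xm] : \forall m \near \oo, forall j, tnth x j < m%:R.
  by apply: filter_forall => j; exact: nbhs_infty_gtr.
by exists m; exact: (xm m (leqnn m)).
Qed.

Lemma measurable_tupleE n :
  @measurable _ (n.-tuple R) = <<s range (@orthant n) >>.
Proof.
apply/seteqP; split; last first.
  apply: smallest_sub; first exact: sigma_algebra_measurable.
  by move=> _ [c _ <-]; exact: measurable_orthant.
pose T1 := g_sigma_algebraType (range (@orthant n)).
have : measurable_fun setT (fun x : T1 => x : n.-tuple R).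
  apply/measurable_fun_tnthP => k.
  apply: (measurability _ (measurable_realfun.RGenInftyO.measurableE R)).
  move=> _ [_ [c ->] <-]; rewrite setTI.
  (* A half-space in coordinate [k] is the union of orthants whose other bounds grow to infinity. *)
  pose b m j : R := if j == k then c else m%:R.
  rewrite (_ : _ @^-1` _ = \bigcup_m orthant (b m)).
    by apply: bigcupT_measurable => m; apply: sub_sigma_algebra; exists (b m).
  apply/seteqP; split=> x /=; rewrite in_itv/=; last first.
    by move=> [m _ /(_ k)]; rewrite /b eqxx.
  move=> xc.
  have [m xm] := tuple_nat_gt x.
  by exists m => // j; rewrite /b; case: eqP => // ->.
by move=> mid A mA; have := mid measurableT A mA; rewrite setTI.
Qed.

Context (I : Type).
Implicit Types X Y L : I -> {RV P >-> R}.

Lemma measurable_sample X n (t : n.-tuple I) :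
  measurable_fun setT (fun w => map_tuple (fun s => X s w) t).
Proof.
apply/measurable_fun_tnthP => k.
rewrite (_ : _ \o _ = X (tnth t k))//.
by apply/funext => w /=; rewrite tnth_map.
Qed.

Lemma measurable_lt_sample X n (t : n.-tuple I) (c : 'I_n -> R) :
  measurable [set w | forall k, X (tnth t k) w < c k].
Proof.
have := measurable_sample X t measurableT (measurable_orthant c).
rewrite setTI (_ : _ @^-1` _ = [set w | forall k, X (tnth t k) w < c k])//.
by apply/seteqP; split=> w /= wc k; have := wc k; rewrite tnth_map.
Qed.

Lemma same_fdd_orthantP X Y : same_fdd X Y <->
  forall n (t : n.-tuple I) (c : 'I_n -> R),
    P [set w | forall k, X (tnth t k) w < c k] =
    P [set w | forall k, Y (tnth t k) w < c k].
Proof.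
have preE Z n (t : n.-tuple I) (c : 'I_n -> R) :
    (fun w => map_tuple (fun s => (Z s : {RV P >-> R}) w) t) @^-1` orthant c =
    [set w | forall k, Z (tnth t k) w < c k].
  by apply/seteqP; split=> w /= wc k; have := wc k; rewrite tnth_map.
split=> [XY n t c|XY n t].
  by have := XY n t _ (measurable_orthant c); rewrite /pushforward !preE.
pose f Z := fun w => map_tuple (fun s => (Z s : {RV P >-> R}) w) t.
(* Packing the sample map as a measurable function makes its pushforward a measure, to which
   uniqueness on a pi-system applies. *)
pose mf Z := @isMeasurableFun.Build _ _ _ _ (f Z) (measurable_sample Z t).
pose F Z : {mfun T >-> n.-tuple R} := HB.pack (f Z) (mf Z).
apply: (measure_unique (range (@orthant n)) (fun m => orthant (fun=> m%:R))
  _ _ _ _ (pushforward P (F X)) (pushforward P (F Y))).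
- exact: measurable_tupleE.
- move=> _ _ [c _ <-] [c' _ <-]; exists (fun k => Num.min (c k) (c' k)) => //.
  apply/seteqP; split=> x /=.
    by move=> xc; split=> k; have := xc k; rewrite lt_min => /andP[].
  by move=> [xc xc'] k; rewrite lt_min xc xc'.
- by move=> m; exists (fun=> m%:R).
- apply/seteqP; split=> // x _.
  by have [m xm] := tuple_nat_gt x; exists m.
- by move=> _ [c _ <-]; have := XY n t c; rewrite -!preE.
- move=> m; apply: le_lt_trans (ltry 1); apply: probability_le1.
  have := measurable_sample X t measurableT (measurable_orthant (fun=> m%:R)).
  by rewrite setTI.
Qed.

Lemma measure_bigcup_fin_le (K : finType) (B : K -> set T) :
  (forall k, measurable (B k)) ->
  (P (\bigcup_(k in [set: K]) B k) <= \sum_k P (B k))%E.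
Proof.
move=> mB; have -> : [set: K] = [set` index_enum K].
  by apply/seteqP; split=> k //= _; exact: mem_index_enum.
rewrite bigcup_seq.
(* Measurability is carried along because subadditivity for two sets requires it. *)
pose Q s x := measurable s /\ (P s <= x)%E.
suff : Q (\big[setU/set0]_k B k) (\sum_k P (B k))%E by case.
rewrite {}/Q; elim/big_ind2 : _ => [|A x A' x' [mA Ax] [mA' Ax']|//].
  by rewrite measure0.
split; first exact: measurableU.
by apply: le_trans (leeD Ax Ax'); exact: measureU2.
Qed.

(* [2 e] of slack absorbs the two approximations [U m ~ L] and [U' m ~ L']. *)
Lemma same_fdd_lim_le (U U' : nat -> I -> {RV P >-> R}) L L' n (t : n.-tuple I)
    (c : 'I_n -> R) :
  (forall m, same_fdd (U m) (U' m)) ->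
  (forall i, cvg_in_prob (U^~ i) (L i)) ->
  (forall i, cvg_in_prob (U'^~ i) (L' i)) ->
  (P [set w | forall k, (L (tnth t k) w < c k)%R] <=
   P [set w | forall k, (L' (tnth t k) w < c k)%R])%E.
Proof.
move=> UU' UL UL'.
(* These events increase to the one on the left, so by continuity from below each may be bounded
   separately. *)
pose A (m : nat) := [set w | forall k, L (tnth t k) w < c k - 2 * m.+1%:R^-1].
have mA m : measurable (A m) by exact: measurable_lt_sample.
have AE : [set w | forall k, L (tnth t k) w < c k] = \bigcup_m A m.
  apply/seteqP; split=> w /=; last first.
    move=> [m _ wA] k; apply: lt_le_trans (wA k) _.
    by rewrite gerBl mulr_ge0.
  move=> wc.
  have : \forall m \near \oo, forall k, L (tnth t k) w < c k - 2 * m.+1%:R^-1.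
    apply: filter_forall => k.
    have e0 : 0 < (c k - L (tnth t k) w) / 2 by rewrite divr_gt0 ?subr_gt0.
    have := @near_infty_natSinv_lt R (PosNum e0).
    apply: filterS => m /= mc; rewrite ltrBrDr -ltrBrDl.
    by rewrite mulrC -ltr_pdivlMr.
  by move=> [m _ Am]; exists m => //; exact: (Am m (leqnn m)).
have ndA : {homo A : n m / (n <= m)%N >-> (n <= m)%O}.
  move=> a b ab; apply/subsetPset => w Aw k; apply: lt_le_trans (Aw k) _.
  by rewrite lerB// ler_pM2l// lef_pV2 ?posrE// ler_nat.
have mUA : measurable (\bigcup_m A m) by exact: bigcupT_measurable.
have PA := nondecreasing_cvg_mu (mu := P) mA mUA ndA.
rewrite AE -(cvg_lim _ PA)//; apply: lime_le; first by apply/cvg_ex; eexists; exact: PA.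
apply: nearW => m; apply/lee_addgt0Pr => del del0; rewrite /=.
pose e : R := m.+1%:R^-1; have e0 : 0 < e by rewrite invr_gt0.
pose bad (V : nat -> I -> {RV P >-> R}) M j :=
  \bigcup_(k in [set: 'I_n])
    [set w | e <= `|V j (tnth t k) w - (M (tnth t k) : {RV P >-> R}) w|].
have mbad V M j : measurable (bad V M j).
  apply: fin_bigcup_measurable => [|k _]; first exact: finite_finset.
  exact: measurable_dist_ge.
have Pbad V M : (forall i, cvg_in_prob (V^~ i) (M i)) ->
    \forall j \near \oo, (P (bad V M j) <= (del / 2)%:E)%E.
  (* The union bound has [n] terms; dividing by [n + 1] also handles [n = 0]. *)
  move=> VM; have dn : 0 < del / 2 / n.+1%:R by rewrite !divr_gt0.
  have : \forall j \near \oo, forall k : 'I_n,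
      (P [set w | (e <= `|V j (tnth t k) w - M (tnth t k) w|)%R] <
       (del / 2 / n.+1%:R)%:E)%E.
    by apply: filter_forall => k; move/cvg_in_probP : (VM (tnth t k)); apply.
  apply: filterS => j Vj; apply: le_trans (measure_bigcup_fin_le _) _.
    by move=> k; exact: measurable_dist_ge.
  apply: (@le_trans _ _ (\sum_(k < n) (del / 2 / n.+1%:R)%:E)%E).
    by apply: lee_sum => k _; exact: ltW.
  rewrite sumEFin lee_fin sumr_const card_ord -[X in X <= _]mulr_natr.
  rewrite -(mulrA (del / 2)) ler_piMr//.
    by rewrite divr_ge0// ltW.
  by rewrite mulrC ler_pdivrMr// mul1r ler_nat.
have [j [Uj U'j]] : exists j, (P (bad U L j) <= (del / 2)%:E)%E /\
                              (P (bad U' L' j) <= (del / 2)%:E)%E.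
  have [j _ H] : \forall j \near \oo, (P (bad U L j) <= (del / 2)%:E)%E /\
                              (P (bad U' L' j) <= (del / 2)%:E)%E.
    by apply: filterS2 (Pbad _ _ UL) (Pbad _ _ UL') => j.
  by exists j; exact: (H j (leqnn j)).
(* Intermediate event with slack [e]: off the bad sets, [A m] implies [B U] and [B U'] implies the
   target, while [B U] and [B U'] have equal probability. *)
pose B (V : nat -> I -> {RV P >-> R}) :=
  [set w | forall k, V j (tnth t k) w < c k - e].
have mB V : measurable (B V) by exact: measurable_lt_sample.
have PB : P (B U) = P (B U') by apply: (same_fdd_orthantP _ _).1; exact: UU'.
rewrite [del]splitr EFinD addeA.
apply: (@le_trans _ _ (P (B U) + (del / 2)%:E)%E).
  apply: le_trans (leeD2l _ Uj); apply: le_trans (measureU2 _ _ _) => //.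
  apply: le_measure; rewrite ?inE//; first exact: measurableU.
  move=> w Aw; have [?|wbad] := pselect (bad U L j w); [by right|left => k].
  have : `|U j (tnth t k) w - L (tnth t k) w| < e.
    by rewrite ltNge; apply/negP => ?; apply: wbad; exists k.
  by rewrite ltr_distl => /andP[_ Ue]; have := Aw k; rewrite -/e; lra.
rewrite PB leeD2r//; apply: le_trans (leeD2l _ U'j).
apply: le_trans (measureU2 _ _ _) => //; last exact: measurable_lt_sample.
apply: le_measure; rewrite ?inE//.
  by apply: measurableU => //; exact: measurable_lt_sample.
move=> w Bw; have [?|wbad] := pselect (bad U' L' j w); [by right|left => k].
have : `|U' j (tnth t k) w - L' (tnth t k) w| < e.
  by rewrite ltNge; apply/negP => ?; apply: wbad; exists k.
by rewrite ltr_distl => /andP[Ue _]; have := Bw k; lra.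
Qed.

Lemma same_fdd_lim (U U' : nat -> I -> {RV P >-> R}) L L' :
  (forall m, same_fdd (U m) (U' m)) ->
  (forall i, cvg_in_prob (U^~ i) (L i)) ->
  (forall i, cvg_in_prob (U'^~ i) (L' i)) -> same_fdd L L'.
Proof.
move=> UU' UL UL'; apply/same_fdd_orthantP => n t c; apply/eqP.
rewrite eq_le (same_fdd_lim_le _ _ UU' UL UL') andTb.
by apply: (same_fdd_lim_le _ _ _ UL' UL) => m k s B mB; rewrite (UU' m).
Qed.

(** A constant sequence converges in probability to anything almost surely equal to it, so this is
    an instance of [same_fdd_lim]. *)
Lemma same_fdd_ae X Y X' Y' : (forall i, X i = X' i %[ae P]) ->
  (forall i, Y i = Y' i %[ae P]) -> same_fdd X Y -> same_fdd X' Y'.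
Proof.
move=> XX' YY' XY; apply: (@same_fdd_lim (fun=> X) (fun=> Y)) => // i.
  exact: cvg_in_prob_ae.
exact: cvg_in_prob_ae.
Qed.

End FiniteDimensionalLaws.

(** * Linear images of fields with equal laws *)

Section LinearCombinations.
Context {R : realType} {d : measure_display} {T : measurableType d}.
Context (P : probability T R).

Lemma same_fdd_lin (I K : eqType) (J : Type) (Z Z' : J -> {RV P >-> R})
    (s : I -> seq K) (c : I -> K -> R) (f : I -> K -> J) :
  same_fdd Z Z' ->
  same_fdd (P := P) (fun i => \sum_(k <- s i) c i k *: (Z (f i k) : rv))
                    (fun i => \sum_(k <- s i) c i k *: (Z' (f i k) : rv)).
Proof.
move=> ZZ' n t B mB.
(* The sample of combinations is a measurable function [h] of one finite sample of [Z], indexed by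
   the pairs in [q]; the default [0] only makes [h] total. *)
pose q := in_tuple [seq (i, k) | i <- t, k <- s i].
pose a (x : (size q).-tuple R) (i : I) : R :=
  \sum_(k <- s i) c i k * nth 0 x (index (i, k) q).
pose h (x : (size q).-tuple R) : n.-tuple R := map_tuple (a x) t.
have mh : measurable_fun setT h.
  apply/measurable_fun_tnthP => j.
  rewrite (_ : _ \o _ = a ^~ (tnth t j)); last first.
    by apply/funext => x /=; rewrite tnth_map.
  apply: measurable_sum => k; apply: measurable_realfun.measurable_funM => //.
  have [kq|kq] := ltnP (index (tnth t j, k) q) (size q); last first.
    rewrite (_ : (fun x => _) = cst 0)//.
    by apply/funext => x; rewrite nth_default// (size_tuple x).
  rewrite (_ : (fun x => _) = (fun x : (size q).-tuple R => tnth x (Ordinal kq))).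
    exact: measurable_tnth.
  by apply/funext => x; rewrite (tnth_nth 0).
have hE (W : J -> {RV P >-> R}) w :
    map_tuple (fun i => (\sum_(k <- s i) c i k *: (W (f i k) : rv) : rv) w) t =
    h (map_tuple (fun p => W p w) (map_tuple (fun p => f p.1 p.2) q)).
  apply: eq_from_tnth => j; rewrite !tnth_map rv_sumE /a.
  apply: eq_big_seq => k ks.
  have pq : (tnth t j, k) \in tval q.
    by apply: allpairs_f_dep => //; exact: mem_tnth.
  by rewrite /= -map_comp (nth_map (tnth t j, k)) ?index_mem// nth_index.
have mhB : measurable (h @^-1` B) by rewrite -[X in measurable X]setTI; exact: mh.
have E (W : J -> {RV P >-> R}) :
    pushforward P (fun w => map_tuple
      (fun i => (\sum_(k <- s i) c i k *: (W (f i k) : rv) : rv) w) t) B =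
    pushforward P (fun w => map_tuple (fun p => W p w)
      (map_tuple (fun p => f p.1 p.2) q)) (h @^-1` B).
  rewrite /pushforward; congr (P _).
  by apply/seteqP; split=> w; rewrite /preimage/= hE.
exact: etrans (E Z) (etrans (ZZ' _ _ _ mhB) (esym (E Z'))).
Qed.

End LinearCombinations.

(** * Decaying fields *)

Section Tails.
Context {R : realType} {d : measure_display} {T : measurableType d}.
Context (P : probability T R).

(** The tail events decrease to the empty set because [X] is finite everywhere; continuity from
    above concludes. *)
Lemma tail_cvg0 (X : {RV P >-> R}) (c del : R) : 0 < c -> 0 < del ->
  \forall k \near \oo, (P [set w | (c * k%:R <= `|X w|)%R] < del%:E)%E.
Proof.
move=> c0 del0; pose F (k : nat) := [set w | c * k%:R <= `|X w|].
have mF k : measurable (F k).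
  rewrite -[X in measurable X]setTI.
  have : measurable_fun setT (fun w => c * k%:R <= `|X w|).
    by apply: measurable_realfun.measurable_fun_ler => //; exact: measurableT_comp.
  by move=> /(_ measurableT [set true] I).
have F0 : \bigcap_k F k = set0.
  apply/seteqP; split=> // w /= Fw.
  have [k _ kw] : \forall k \near \oo, `|X w| / c < k%:R by exact: nbhs_infty_gtr.
  have := Fw k I; have := kw k (leqnn k).
  by rewrite /F /= ltr_pdivrMr// mulrC ltNge => /negP.
have ndF : {homo F : n m / (n <= m)%N >-> (m <= n)%O}.
  move=> a b ab; apply/subsetPset => w; rewrite /F/=; apply: le_trans.
  by rewrite ler_pM2l// ler_nat.
have F0oo : (P (F 0%N) < +oo)%E.
  exact: le_lt_trans (probability_le1 P (mF 0%N)) (ltry 1).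
have mFcap : measurable (\bigcap_k F k) by rewrite F0.
have := nonincreasing_cvg_mu (mu := P) F0oo mF mFcap ndF.
rewrite F0 measure0 => /fine_cvgP[_ /cvgr0Pnorm_lt/(_ _ del0)].
apply: filterS => k /=; rewrite ger0_norm ?fine_ge0 ?measure_ge0//.
by rewrite -lte_fin fineK// fin_num_measure.
Qed.

Lemma same_fdd_marginal (I : Type) (X Y : I -> {RV P >-> R}) (i : I) (A : set R) :
  same_fdd X Y -> measurable A -> P (X i @^-1` A) = P (Y i @^-1` A).
Proof.
move=> XY mA.
have mB : measurable ((fun x : 1.-tuple R => tnth x ord0) @^-1` A).
  by rewrite -[X in measurable X]setTI; exact: measurable_tnth.
have := XY 1%N [tuple i] _ mB; rewrite /pushforward.
by congr (P _ = P _); apply/seteqP; split=> w /=; rewrite /preimage/= tnth_map.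
Qed.

End Tails.

Section DecayingFields.
Context {R : realType} {d : measure_display} {T : measurableType d}.
Context (P : probability T R) (N : nat).
Implicit Types (t : 'rV[int]_N) (l : 'I_N) (W : 'rV[int]_N -> {RV P >-> R}).

Definition decaying W : Prop := forall l t,
  cvg_in_prob (fun k : nat => W (set_coord t l (- k%:Z))) (0 : rv).

Let rtele1 m l W : 'rV[int]_N -> {RV P >-> R} := tele1 m l (W : _ -> rv).
Let rtele s W : 'rV[int]_N -> {RV P >-> R} := tele s (W : _ -> rv).

(** Along [l] the two corners coincide once the coordinate is below [-m], so the field is eventually
    zero; along any other coordinate both terms decay. *)
Lemma decaying_tele1 m l W : decaying W -> decaying (rtele1 m l W).
Proof.
move=> Wd l' t; have [->|ll'] := eqVneq l' l.
  apply: (@cvg_in_prob_near _ _ _ _ _ (fun=> (0 : rv))).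
    exists m.+1 => // k /= mk; rewrite /rtele1 /tele1 set_coord_same set_coord_twice.
    have -> : Num.min (- k%:Z) (- m%:Z - 1) = - k%:Z by lia.
    exact: (@subrr rv).
  exact/cvg_in_prob_ae/ae_eq_refl.
pose b := Num.min (t 0 l) (- m%:Z - 1).
have := cvg_in_probB (Wd l' t) (Wd l' (set_coord t l b)).
rewrite subrr; apply: cvg_in_prob_near; apply: nearW => k.
by rewrite /rtele1 /tele1 set_coord_neq// set_coordC// eq_sym.
Qed.

Lemma tele1_cvg l W t : decaying W -> cvg_in_prob (fun m => rtele1 m l W t) (W t).
Proof.
move=> Wd.
have WW : cvg_in_prob (fun=> W t) (W t) by exact/cvg_in_prob_ae/ae_eq_refl.
(* The shift by [1] reflects the lower corner at [-m - 1], outside the segment. *)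
have := cvg_in_probB WW (cvg_in_prob_comp (@cvg_addnl 1) (Wd l t)).
rewrite subr0; apply: cvg_in_prob_near.
exists (absz (t 0 l)) => // m /= tm; rewrite /rtele1 /tele1.
by have -> : Num.min (t 0 l) (- m%:Z - 1) = - (1 + m)%N%:Z by lia.
Qed.

(** With the outermost bound [m] fixed, the inner limits give [tele1 m l W t], since [tele1 m l W]
    decays too; then [m] tends to infinity. *)
Lemma iter_lim_tele n (ls : seq 'I_N) W t : size ls = n -> uniq ls -> decaying W ->
  iter_lim (fun M : n.-tuple nat => rtele (zip ls M) W t) (W t).
Proof.
elim: n ls W => [|n IHn] [|l ls] W //=.
  by move=> _ _ _; exact: ae_eq_refl.
move=> [sz] /andP[lNls uls] Wd; exists (fun m => rtele1 m l W t); last first.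
  exact: tele1_cvg.
move=> m; have := IHn ls _ sz uls (decaying_tele1 m l Wd).
congr iter_lim; apply/funext => M.
rewrite /rtele /rtele1 /= tele1_tele//.
by rewrite -/unzip1 unzip1_zip// size_tuple sz.
Qed.

(** The same induction on coordinates, applied to whole fields, since joint laws must survive each
    limit. *)
Lemma same_fdd_tele n (ls : seq 'I_N) W W' : size ls = n -> uniq ls ->
  decaying W -> decaying W' ->
  (forall M : n.-tuple nat, same_fdd (rtele (zip ls M) W) (rtele (zip ls M) W')) ->
  same_fdd W W'.
Proof.
elim: n ls W W' => [|n IHn] [|l ls] W W' //=.
  by move=> _ _ _ _ /(_ [tuple]).
move=> [sz] /andP[lNls uls] Wd Wd' WW'.
apply: (@same_fdd_lim _ _ _ _ _ (fun m => rtele1 m l W) (fun m => rtele1 m l W')).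
- move=> m; apply: (IHn _ _ _ sz uls); [exact: decaying_tele1|exact: decaying_tele1|].
  move=> M; have := WW' [tuple of m :: M].
  rewrite /rtele /rtele1 /=.
  have lz : l \notin [seq i.1 | i <- zip ls M].
    by rewrite -/unzip1 unzip1_zip// size_tuple sz.
  by congr same_fdd; exact: tele1_tele.
- by move=> t; exact: tele1_cvg.
- by move=> t; exact: tele1_cvg.
Qed.

End DecayingFields.

(** * Discounted fields *)

Section Discounting.
Context {R : realType} {d : measure_display} {T : measurableType d}.
Context (P : probability T R) (N : nat) (Theta : 'rV[R]_N).
Implicit Types (s t : 'rV[int]_N) (X G : 'rV[int]_N -> {RV P >-> R}).

(** Only the argument of [X] is shifted, not the weight, so stationarity of [X] means that the law
    of this field does not depend on [s]. *)
Definition discount X s t : {RV P >-> R} :=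
  expR (inner t Theta) *: (X (t + s) : rv).

Definition innovation X t : {RV P >-> R} :=
  \sum_(i : {ffun 'I_N -> bool})
    ((-1) ^+ (\sum_l i l)%N * expR (- inner (corner i) Theta))
      *: (X (t - corner i) : rv).

Lemma innerB t s : inner (t - s) Theta = inner t Theta - inner s Theta.
Proof.
rewrite /inner -sumrB; apply: eq_bigr => l _.
by rewrite !mxE rmorphB/= mulrBl.
Qed.

Lemma inner_set_coord t l v : inner (set_coord t l v) Theta =
  inner (set_coord t l 0) Theta + v%:~R * Theta 0 l.
Proof.
rewrite /inner (bigD1 l)//= [in RHS](bigD1 l)//= !set_coord_same mul0r add0r.
rewrite addrC; congr (_ + _); apply: eq_bigr => i il.
by rewrite !set_coord_neq// eq_sym.
Qed.

(** The weight at [t - corner i] splits into the weight at [t] and the coefficient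
    [expR (- inner (corner i) Theta)] of the innovation. *)
Lemma nincr_discount X s t : nincr (discount X s : _ -> rv) t =
  expR (inner t Theta) *: (innovation X (t + s) : rv).
Proof.
rewrite /nincr /innovation scaler_sumr; apply: eq_bigr => i _.
rewrite /discount !scalerA innerB expRD addrAC; congr (_ *: _).
by rewrite mulrCA mulrA.
Qed.

Lemma sum_lagE (V : lmodType R) (Y : 'rV[int]_N -> V) t :
  \sum_(i : {ffun 'I_N -> bool})
    ((-1) ^+ (\sum_l i l)%N * expR (- inner (corner i) Theta))
      *: Y (t - corner i) =
  Y t - \sum_(i : {ffun 'I_N -> bool} | i != [ffun=> false])
    ((-1) ^+ (1 + \sum_l i l)%N * expR (- inner (corner i) Theta))
      *: Y (t - corner i).
Proof.
rewrite (bigD1 [ffun=> false])//=; congr (_ + _); last first.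
  by rewrite -[RHS]sumrN; apply: eq_bigr => i _;
     rewrite exprS mulN1r mulNr scaleNr opprK.
rewrite big1 => [|l _]; last by rewrite ffunE.
have -> : corner [ffun=> false] = 0 :> 'rV[int]_N.
  by apply/rowP => l; rewrite !mxE ffunE.
have -> : inner 0 Theta = 0 by rewrite /inner big1// => l _; rewrite mxE mul0r.
by rewrite oppr0 expR0 mulr1 scale1r subr0.
Qed.

Lemma innovationE X t :
  innovation X t = (X t : rv) - (lag_comb Theta X t : rv).
Proof. exact: (sum_lagE (V := rv)). Qed.

Lemma AR_repE X G : AR_rep Theta X G <->
  forall t, incr G t = innovation X t %[ae P].
Proof.
split=> XG t; move: (XG t); apply: filterS => w /= /(_ I) E _.
  by rewrite innovationE -[RHS]/(X t w - lag_comb Theta X t w) E /= addrC addKr.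
by rewrite E innovationE -[X in _ = _ + X]/(X t w - lag_comb Theta X t w) addrC subrK.
Qed.

Lemma decaying_discount X s : decay Theta X -> decaying (discount X s).
Proof.
move=> Xd l t; pose z : int := s 0 l.
(* After the shift, coordinate [l] equals [-(k - z)]: [phi k] is [k - z] for large [k], and [c]
   collects the part of the weight independent of [k]. *)
pose c := expR (inner (set_coord t l 0) Theta - (z)%:~R * Theta 0 l).
pose phi (k : nat) : nat := `|(k%:Z - z)%R|%N.
have phioo : phi k @[k --> \oo] --> \oo.
  apply/cvgnyPge => A; exists (A + absz (z))%N => // k /= Ak.
  by rewrite /phi; lia.
have := cvg_in_probZ c (cvg_in_prob_comp phioo (Xd l (t + s))).
have -> : c *: (cst 0 : @rv R d T) = 0.
  by apply: rv_ext => w; exact: mulr0.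
apply: cvg_in_prob_near.
exists (absz (z)) => // k /= sk.
have phiE : (phi k)%:Z = k%:Z - z by rewrite /phi; lia.
rewrite /discount /c scalerA -expRD; congr (expR _ *: _).
  rewrite inner_set_coord phiE -addrA; congr (_ + _).
  by rewrite opprB rmorphB/= rmorphN/= mulrBl mulNr addKr.
congr (X _); apply/rowP => i; rewrite phiE !mxE.
by case: eqP => // ->; rewrite opprB addrC.
Qed.

Lemma stationary_innovation X : stationary X -> stationary (innovation X).
Proof.
move=> Xs s.
have := same_fdd_lin (fun=> index_enum {ffun 'I_N -> bool})
  (fun _ i => (-1) ^+ (\sum_l i l)%N * expR (- inner (corner i) Theta))
  (fun t i => t - corner i) (Xs s).
congr same_fdd; apply/funext => t; apply: eq_bigr => i _.
by rewrite addrAC.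
Qed.

(** Every [X u] has the law of [X 0], and [expR x >= 1 + x] turns the exponential threshold into the
    linear one of [tail_cvg0]. *)
Lemma stationary_decay X : (forall l, 0 < Theta 0 l) ->
  stationary X -> decay Theta X.
Proof.
move=> Theta_gt0 Xs l t; apply/cvg_in_probP => eps del eps0 del0.
have c0 : 0 < eps * Theta 0 l by rewrite mulr_gt0.
apply: filterS (tail_cvg0 (X 0) c0 del0) => k; apply: le_lt_trans.
set e := expR _.
have mA : measurable [set x : R | eps <= `|e * x - 0|].
  rewrite -[X in measurable X]setTI.
  have : measurable_fun setT (fun x : R => eps <= `|e * x - 0|).
    apply: measurable_realfun.measurable_fun_ler => //;
      apply: measurableT_comp => //.
    by apply: measurable_realfun.measurable_funB => //;
      exact: measurable_realfun.measurable_funM.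
  by move=> /(_ measurableT [set true] I).
set u := set_coord _ _ _.
have := same_fdd_marginal 0 (Xs u) mA; rewrite add0r => Xu.
rewrite -[X in (P X <= _)%E]/(X u @^-1` [set x : R | eps <= `|e * x - 0|]) Xu.
apply: le_measure; rewrite ?inE.
- by rewrite -[X in measurable X]setTI; exact: (measurable_funPT (X 0)).
- rewrite -[X in measurable X]setTI.
  have : measurable_fun setT (fun w => eps * Theta 0 l * k%:R <= `|X 0 w|).
    by apply: measurable_realfun.measurable_fun_ler => //; exact: measurableT_comp.
  by move=> /(_ measurableT [set true] I).
move=> w /=; rewrite subr0 normrM gtr0_norm ?expR_gt0// /e rmorphN/= mulNr expRN.
rewrite -[X in _ <= X]mulrC ler_pdivlMr ?expR_gt0//; apply: le_trans.
rewrite -mulrA ler_pM2l// mulrC.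
by apply: le_trans (expR_ge1Dx _); rewrite lerDr.
Qed.

(** * Stationarity from the autoregressive equation *)

Lemma ae_eq_sum (J : Type) (r : seq J) (F F' : J -> {RV P >-> R}) :
  (forall j, F j = F' j %[ae P]) ->
  (\sum_(j <- r) (F j : rv) : rv) = (\sum_(j <- r) (F' j : rv) : rv) %[ae P].
Proof.
move=> FF'; elim: r => [|j r IHr]; first by rewrite !big_nil; exact: ae_eq_refl.
rewrite !big_cons; apply: filterS2 (FF' j) IHr => w /(_ I) E1 /(_ I) E2 _.
by rewrite -[LHS]/(F j w + (\sum_(j <- r) (F j : rv) : rv) w) E1 E2.
Qed.

Lemma box_sumE G t M :
  \sum_(j \in box t M) expR (inner j Theta) *: incr G j =
  \sum_(j <- box_seq t M) expR (inner j Theta) *: (incr G j : rv).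
Proof. by rewrite -box_seqE [RHS]fsbig_seq ?box_seq_uniq. Qed.

Lemma stationary_AR X G : decay Theta X -> stationary_increments G ->
  AR_rep Theta X G -> stationary X.
Proof.
move=> Xd Gs /AR_repE XG s.
have DD : same_fdd (discount X s) (discount X 0).
  apply: (@same_fdd_tele _ _ _ _ _ N (enum 'I_N)).
  - by rewrite size_enum_ord.
  - exact: enum_uniq.
  - exact: decaying_discount.
  - exact: decaying_discount.
  move=> M.
  have teleE s' t :
      (\sum_(j <- box_seq t M)
         expR (inner j Theta) *: (incr G (j + s') : rv) : rv) =
      (tele (zip (enum 'I_N) M) (discount X s' : _ -> rv) t : rv) %[ae P].
    rewrite -sum_box_nincr; apply: ae_eq_sum => j; rewrite nincr_discount.
    move: (XG (j + s')); apply: filterS => w /(_ I) E _.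
    by rewrite -[LHS]/(expR (inner j Theta) * incr G (j + s') w) E.
  apply: same_fdd_ae (teleE s) (teleE 0) _.
  (* For fixed bounds, both box sums are the same linear image of shifted increments of [G], whose
     law is shift invariant. *)
  apply: (@same_fdd_lin _ _ _ _ _ _ _ (fun j => incr G (j + s))
    (fun j => incr G (j + 0)) (fun t => box_seq t M)
    (fun _ j => expR (inner j Theta)) (fun _ j => j)).
  have := Gs s; congr same_fdd.
  by apply/funext => j; rewrite addr0.
(* Removing the deterministic weights returns from the discounted fields to [X]. *)
have := same_fdd_lin (fun t => [:: t]) (fun t _ => expR (- inner t Theta))
  (fun t _ => t) DD.
congr same_fdd; apply/funext => t; rewrite big_seq1 /discount scalerA.
  by rewrite -expRD addNr expR0 scale1r.
by rewrite -expRD addNr expR0 scale1r addr0.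
Qed.

(** * Existence and uniqueness of the field G *)

Lemma incr_antincr X t : (0 < N)%N ->
  incr (antincr (innovation X : _ -> rv)) t = innovation X t.
Proof. by move=> N0; rewrite -[RHS](nincr_antincr (V := rv)). Qed.

Lemma class_G_antincr X : (0 < N)%N -> (forall l, 0 < Theta 0 l) ->
  stationary X ->
  class_G (P := P) Theta (antincr (innovation X : _ -> rv)).
Proof.
move=> N0 Theta_gt0 Xs.
have incrE : incr (P := P) (antincr (innovation X : _ -> rv)) = innovation X.
  by apply/funext => t; exact: incr_antincr.
split.
- by rewrite /stationary_increments incrE; exact: stationary_innovation.
- by move=> t th; rewrite antincr_strip//; exact: ae_eq_refl.
(* The box sums telescope, so their iterated limit is the discounted value of [X] at [t]. *)
move=> t; exists (discount X 0 t).
have := iter_lim_tele t (size_enum_ord N) (enum_uniq _)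
  (decaying_discount 0 (stationary_decay Theta_gt0 Xs)).
congr iter_lim; apply/funext => M; rewrite box_sumE incrE -sum_box_nincr.
by apply: eq_bigr => j _; rewrite nincr_discount addr0.
Qed.

(** The difference has almost surely zero increments and vanishes on the strip, so
    [nincr_determines] applies to the property of being almost surely zero. *)
Lemma class_G_unique X G G' : (0 < N)%N ->
  class_G Theta G -> AR_rep Theta X G ->
  class_G Theta G' -> AR_rep Theta X G' -> forall t, G t = G' t %[ae P].
Proof.
move=> N0 [_ G0 _] /AR_repE XG [_ G'0 _] /AR_repE XG' t.
pose D t : @rv R d T := (G t : rv) - (G' t : rv).
pose E (x : @rv R d T) := \forall w \ae P, x w = 0.
suff : E (D t).
  by apply: filterS => w Dw _; apply/eqP; rewrite -subr_eq0; apply/eqP.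
apply: nincr_determines => //.
- move=> x y; apply: filterS2 => w xw yw.
  by rewrite -[LHS]/(x w + y w) xw yw addr0.
- move=> a x; apply: filterS => w xw.
  by rewrite -[LHS]/(a * x w) xw mulr0.
- exact: nearW.
- move=> u; have -> : nincr D u = (incr G u : rv) - (incr G' u : rv).
    rewrite /incr -[RHS](@sumrB rv); apply: eq_bigr => i _.
    by rewrite /D scalerBr.
  apply: filterS2 (XG u) (XG' u) => w /(_ I) E1 /(_ I) E2.
  by rewrite -[LHS]/(incr G u w - incr G' u w) E1 E2 subrr.
move=> u hu; apply: filterS2 (G0 u hu) (G'0 u hu) => w /(_ I) E1 /(_ I) E2.
by rewrite -[LHS]/(G u w - G' u w) E1 E2 subrr.
Qed.

End Discounting.

Theorem theorem2p20 (R : realType) (d : measure_display) (T : measurableType d)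
    (P : probability T R) (N : nat) (N_gt0 : (0 < N)%N)
    (Theta : 'rV[R]_N) (Theta_gt0 : forall l, 0 < Theta 0 l)
    (X : 'rV[int]_N -> {RV P >-> R}) :
  (stationary X <->
     decay Theta X /\
     exists G : 'rV[int]_N -> {RV P >-> R},
       class_G Theta G /\ AR_rep Theta X G) /\
  (stationary X ->
     forall G G' : 'rV[int]_N -> {RV P >-> R},
       class_G Theta G -> AR_rep Theta X G ->
       class_G Theta G' -> AR_rep Theta X G' ->
       forall t, G t = G' t %[ae P]).
Proof.
split; last by move=> _ G G'; exact: class_G_unique.
split=> [Xs|[Xd [G [[Gs _ _] XG]]]]; last exact: stationary_AR XG.
split; first exact: stationary_decay.
exists (antincr (innovation Theta X : _ -> rv)).
split; first exact: class_G_antincr.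
by apply/AR_repE => t; rewrite incr_antincr//; exact: ae_eq_refl.
Qed.
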